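(* For every integer $p\ge2$, the natural LP of a $p$-matchoid has integrality gap at most $p-1+\frac1p$. That is: for every $p$-matchoid given by matroids $M_j=(E_j,\mathcal{I}_j)$, $j=1,\ldots,m$, with $E=\bigcup_{j=1}^mE_j$, and every weight vector $w\in\mathbb{R}^E$, $$\max\{w\cdot x: x\in P_{\mathcal{L}}\}\ \le\ \Bigl(p-1+\frac1p\Bigr)\cdot\max\Bigl\{\sum_{e\in I}w_e: I\in\mathcal{F}_{\mathcal{L}}\Bigr\}.$$
   Context: Let $\mathcal{L}=\{M_j=(E_j,\mathcal{I}_j):j=1,\ldots,m\}$ be a finite collection of matroids on possibly overlapping finite sets $E_j$ (the local ground sets), and let $E=\bigcup_{j=1}^mE_j$. The collection is a $p$-matchoid if every element of $E$ belongs to at most $p$ of the sets $E_j$. Its feasible sets are $$\mathcal{F}_{\mathcal{L}}=\{I\subseteq E: I\cap E_j\in\mathcal{I}_j\ \text{for every } j\}.$$ For a matroid $M$ on $E'$ with rank function $r_M$, its independent set polytope is $P(M)=\{y\in\mathbb{R}_{\ge0}^{E'}:\sum_{e\in S}y_e\le r_M(S)\ \forall S\subseteq E'\}$. The natural LP of the $p$-matchoid maximizes $w\cdot x$ over $$P_{\mathcal{L}}=\{x\in[0,1]^E: x|_{E_j}\in P(M_j)\ \text{for every } j\}.$$ The integrality gap is the worst-case ratio between the LP optimum and the maximum weight of a set in $\mathcal{F}_{\mathcal{L}}$. *)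

(* Defs.v *)
From mathcomp Require Import all_boot all_order all_algebra.
From mathcomp Require Import classical_sets reals.

Set Implicit Arguments.
Unset Strict Implicit.
Unset Printing Implicit Defensive.

Import Order.TTheory GRing.Theory Num.Theory.

Local Open Scope ring_scope.

(* The ground set is a subset of the ambient finite type [T], so that matroids
   on overlapping ground sets can be collected in one family. *)
Record matroid (T : finType) := Matroid {
  ground : {set T};
  indep : {set {set T}};
  indep_ground : forall I : {set T}, I \in indep -> I \subset ground;
  indep0 : finset.set0 \in indep;
  indep_sub : forall I J : {set T}, J \in indep -> I \subset J -> I \in indep;
  indep_aug : forall I J : {set T}, I \in indep -> J \in indep ->
    (#|I| < #|J|)%N -> exists2 e, e \in J :\: I & e |: I \in indep
}.

Definition rank (T : finType) (M : matroid T) (S : {set T}) : nat :=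
  \max_(I in indep M | I \subset S) #|I|.

(* Membership in P(M) of the restriction of [y] to [ground M]; the values of
   [y] outside [ground M] are not constrained. *)
Definition indep_polytope (R : realType) (T : finType) (M : matroid T) :
    set (T -> R) :=
  [set y | (forall e, e \in ground M -> 0 <= y e) /\
           (forall S : {set T}, S \subset ground M ->
              \sum_(e in S) y e <= (rank M S)%:R)]%classic.

(* [T] itself plays the role of E, hence the covering condition. Membership is
   counted by index, so equal ground sets with different indices are counted
   separately. *)
Definition is_matchoid (T : finType) (m : nat) (M : 'I_m -> matroid T)
    (p : nat) : Prop :=
  (\bigcup_(j < m) ground (M j))%SET = [set: T]%SET /\
  (forall e : T, (#|[set j : 'I_m | e \in ground (M j)]%SET| <= p)%N).

Definition feasible (T : finType) (m : nat) (M : 'I_m -> matroid T) :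
    set {set T} :=
  [set I | forall j, I :&: ground (M j) \in indep (M j)]%classic.

Definition matchoid_polytope (R : realType) (T : finType) (m : nat)
    (M : 'I_m -> matroid T) : set (T -> R) :=
  [set x | (forall e, 0 <= x e <= 1) /\
           (forall j, indep_polytope (M j) x)]%classic.

Definition is_max (R : realType) (A : set R) (v : R) : Prop :=
  A v /\ ubound A v.

(* Main.v *)
Require Import Defs.
From mathcomp Require Import boolp classical_sets reals topology normedtype derive.
From mathcomp Require Import all_boot all_order all_algebra ring lra.

(** Why the gap is at most [a = p - 1 + 1/p].

    The proof deletes elements from the matchoid one at a time and puts them
    back, as in fractional local ratio arguments for hypergraph matching.  In a
    hypergraph matching an element [e] can be put back unless a vertex of [e] is
    already covered; in a matroid the obstruction is that [e] is spanned, and a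
    bound on how often this happens has to survive all later deletions.  The
    device that makes this work is that a deleted element is never forgotten:
    each matroid that contains it keeps a private copy of it, a local element,
    with its own weight.  A solution then consists of a global set [I] and, for
    each [j], a local set [B j] such that [(I :&: ground (M j)) :|: B j] is
    independent in [M j]; the local copy of [e] in [B j] certifies that [M j]
    still has room for [e].

    With [X] the set of elements that are not yet deleted, [c j] the weights of
    local elements and [B0 j] independent sets of local elements, the statement
    proved by induction on [X] ([roundable]) says that some solution has weight
    at least
      [1/a * (weight of the fractional point) + (1 - 1/a) * (weight of B0)].
    The term in [B0] says that on a fraction [1 - 1/a] of the time the local
    elements are entirely free, which is where the factor [a] is paid.

    Since the bound is linear in the fractional point, this point may be taken
    to be an extreme optimum ([relaxation_extreme_maximizer]).  For such a point
    either some remaining element has value [0] or at least [1/p], or nothing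
    remains and the point is integral ([extreme_integral]): the tight rank
    constraints of one matroid are spanned by disjoint classes, each of integer
    mass at least [1], while the classes number at least as many as the
    fractional coordinates; every coordinate lies in at most [p] matroids, and a
    local one in a single matroid, so values below [1/p] cannot supply this mass.

    An element [e] of value [x >= 1/p] is deleted with local weights
    [k j + b], where [k j] is the loss of weight that [B0 j] suffers when it has
    to make room for [e], and [b] is what remains of [w e] after these losses
    (if nothing remains, [b <= 0] makes the copies weigh [w e] together and the
    loss below vanishes).  Given a solution without [e], either all copies of [e] are present and they are
    replaced by [e] itself, or some copy is absent and the others are replaced
    by symmetric exchange with [B0 j], which recovers [k j] each
    ([local_exchange]).  If [q <= p] matroids contain [e], both options lose at
    most [(q - 1) * b], and [q - (q - 1) * x <= a] pays for it
    ([reinsertion_gap], [roundable_reinsert]). *)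

Set Implicit Arguments.
Unset Strict Implicit.
Unset Printing Implicit Defensive.

Import Order.TTheory GRing.Theory Num.Theory numFieldNormedType.Exports.
Local Open Scope ring_scope.

(** * Matroids: rank and symmetric exchange *)

Section Matroid.
Variables (T : finType) (M : matroid T).
Implicit Types (A B I J P Q S : {set T}) (e : T).

(** Repeated augmentation of [I] by elements of [J]. *)
Lemma indep_augment_from I J : I \in indep M -> J \in indep M ->
  exists K : {set T}, [/\ K \in indep M, I \subset K, K \subset I :|: J
                        & (#|J| <= #|K|)%N].
Proof.
have [n le_n] := ubnP (#|J| - #|I|); elim: n I le_n => // n IH I le_n iI iJ.
have [leJI|ltIJ] := leqP #|J| #|I|; first by exists I; rewrite subsetUl.
have [f /setDP[fJ fI] ifI] := indep_aug iI iJ ltIJ.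
have cfI : #|f |: I| = #|I|.+1 by rewrite cardsU1 fI.
have [|K [iK sIK sK leK]] := IH (f |: I) _ ifI iJ.
  by rewrite cfI -ltnS (leq_trans _ le_n) // ltnS ltn_sub2l.
exists K; split=> //; first exact: subset_trans (subsetUr _ _) sIK.
apply: subset_trans sK _; rewrite subUset subsetUr andbT subUset subsetUl andbT.
by rewrite sub1set inE fJ orbT.
Qed.

Lemma card_le_rank I S : I \in indep M -> I \subset S -> (#|I| <= rank M S)%N.
Proof.
by move=> iI sIS; apply: leq_bigmax_cond; rewrite iI.
Qed.

Lemma rank_basis S : exists I : {set T},
  [/\ I \in indep M, I \subset S & #|I| = rank M S].
Proof.
pose ok (I : {set T}) := (I \in indep M) && (I \subset S).
have [|I /andP[iI sI] eqI] := @eq_bigmax_cond _ ok (fun I => #|I|).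
  by apply/card_gt0P; exists finset.set0; rewrite unfold_in /ok indep0 sub0set.
by exists I; split.
Qed.

Lemma rank_mono S S' : S \subset S' -> (rank M S <= rank M S')%N.
Proof.
move=> sS; have [I [iI sI <-]] := rank_basis S.
exact: card_le_rank iI (subset_trans sI sS).
Qed.

Lemma rank_le_card S : (rank M S <= #|S|)%N.
Proof. by have [I [_ sI <-]] := rank_basis S; exact: subset_leq_card. Qed.

Lemma indep_of_rank S : (#|S| <= rank M S)%N -> S \in indep M.
Proof.
have [I [iI sI <-]] := rank_basis S => leSI.
by have /eqP <- : I == S by rewrite eqEcard sI.
Qed.

(** A basis of [A :&: B] extends to a basis of [A :|: B], whose traces on [A]
    and [B] are independent and overlap in at least the smaller basis. *)
Lemma rank_submod A B :
  (rank M (A :|: B) + rank M (A :&: B) <= rank M A + rank M B)%N.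
Proof.
have [I [iI sI cI]] := rank_basis (A :&: B).
have [J0 [iJ0 sJ0 cJ0]] := rank_basis (A :|: B).
have [J [iJ sIJ sJ cJ]] := indep_augment_from iI iJ0.
have sJAB : J \subset A :|: B.
  apply: subset_trans sJ _; rewrite subUset sJ0 andbT.
  exact: subset_trans sI (subset_trans (subsetIl _ _) (subsetUl _ _)).
rewrite -cI -cJ0.
have hA : (#|J :&: A| <= rank M A)%N.
  by apply: card_le_rank; [exact: indep_sub iJ (subsetIl _ _)|exact: subsetIr].
have hB : (#|J :&: B| <= rank M B)%N.
  by apply: card_le_rank; [exact: indep_sub iJ (subsetIl _ _)|exact: subsetIr].
apply: leq_trans (leq_add hA hB).
rewrite -[leqRHS]cardsUI -setIUr (setIidPl sJAB) -setIIr.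
by apply: leq_add => //; rewrite subset_leq_card // subsetI sIJ.
Qed.

(** Adding [e] to [Q] closes a circuit.  If no element of this circuit could
    replace [e] in [P], the circuit without [e] would be spanned by [P :\ e],
    hence so would [e], although [P] is independent. *)
Lemma indep_symmetric_exchange P Q e :
  P \in indep M -> Q \in indep M -> e \in P -> e \notin Q ->
  e |: Q \notin indep M ->
  exists q, [/\ q \in Q, q \notin P, q |: (P :\ e) \in indep M
              & (e |: Q) :\ q \in indep M].
Proof.
move=> iP iQ eP eQ deQ.
(* a minimal C makes e |: C a circuit *)
pose dep (C : {set T}) := (C \subset Q) && (e |: C \notin indep M).
have [C /minsetP[/andP[sCQ dC] minC] _] : {C | minset dep C & C \subset Q}.
  by apply: minset_exists; rewrite /dep subxx.
have eC : e \notin C by apply: contra eQ; apply/subsetP.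
have iC : C \in indep M := indep_sub iQ sCQ.
have iPe : P :\ e \in indep M := indep_sub iP (subsetDl _ _).
have cP : #|P| = #|P :\ e|.+1 by rewrite (cardsD1 e) eP.
(* some q of the circuit e |: C extends P :\ e *)
have [q qC /andP[qPe iqP]] : exists2 q, q \in C
    & (q \notin P :\ e) && (q |: (P :\ e) \in indep M).
  have [leC|ltC] := leqP #|C| #|P :\ e|; last first.
    have [q /setDP[qC qP] iqP] := indep_aug iPe iC ltC.
    by exists q; rewrite // qP.
  have [K [iK sCK sK leK]] := indep_augment_from iC iPe.
  have [K' [iK' leK' sK']] : exists K' : {set T},
      [/\ K' \in indep M, (#|P :\ e| < #|K'|)%N & K' \subset C :|: (P :\ e)].
    have [ltK|leK2] := ltnP #|P :\ e| #|K|; first by exists K.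
    have ltKP : (#|K| < #|P|)%N by rewrite cP ltnS.
    have [f /setDP[fP fK] ifK] := indep_aug iK iP ltKP.
    have fe : f != e.
      apply: contraNneq dC => fe; rewrite -fe.
      by apply: indep_sub ifK _; exact: setUS.
    exists (f |: K); split=> //; first by rewrite cardsU1 fK ltnS.
    by rewrite subUset sK andbT sub1set !inE fe fP orbT.
  have [q /setDP[qK qP] iqP] := indep_aug iPe iK' leK'.
  exists q; last by rewrite qP.
  by have := subsetP sK' _ qK; rewrite inE (negPf qP) orbF.
have qQ : q \in Q := subsetP sCQ _ qC.
have qe : q != e by apply: contraNneq eQ => <-.
exists q; split=> //; first by move: qPe; rewrite !inE qe.
have iCq : e |: (C :\ q) \in indep M.
  apply: contraT => dCq.
  have /minC : dep (C :\ q) by rewrite /dep dCq (subset_trans (subsetDl _ _) sCQ).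
  by move=> /(_ (subsetDl _ _)) /setP /(_ q); rewrite !inE eqxx qC.
have [K [iK sK sK2 leK]] := indep_augment_from iCq iQ.
have sKeQ : K \subset e |: Q.
  apply: subset_trans sK2 _; rewrite subUset subsetUr andbT setUS //.
  exact: subset_trans (subsetDl _ _) sCQ.
have qK : q \notin K.
  apply/negP => qK; case/negP: dC; apply: indep_sub iK _.
  apply/subsetP => z; rewrite inE => /orP[/set1P->|zC].
    by apply: (subsetP sK); rewrite !inE eqxx.
  have [->//|zq] := eqVneq z q.
  by apply: (subsetP sK); rewrite !inE zq zC orbT.
suff <- : K = (e |: Q) :\ q by [].
apply/eqP; rewrite eqEcard subsetD1 sKeQ qK /=.
have := cardsD1 q (e |: Q); rewrite cardsU1 eQ !inE qQ orbT /= !add1n.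
by case=> <-.
Qed.

End Matroid.

Section WeightedExchange.
Variables (R : realDomainType) (T : finType) (M : matroid T).
Implicit Types (A B Q : {set T}).

(** Among the sets of local elements, those in [D], let [B1] be a heaviest one
    that leaves room for [e]; then [c(Q) - c(B1)] is at most what [Q] loses when
    it makes room for [e].  A set of local elements that accompanies [e] next to
    the global elements [A] recovers at least that much when [e] leaves: the
    element that [Q] gives up in the symmetric exchange takes the place of [e].
    This is submodularity of the weighted rank, in the form of an exchange. *)
Lemma local_exchange (c : T -> R) (e : T) (A B Q B1 D : {set T}) :
  e \notin A -> e \in B -> e \notin D -> Q \subset D -> B :\ e \subset D ->
  A :|: B \in indep M -> Q \in indep M ->
  (forall B0 : {set T}, B0 \subset D -> e |: B0 \in indep M ->
     \sum_(f in B0) c f <= \sum_(f in B1) c f) ->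
  exists B' : {set T}, [/\ B' \subset D, A :|: B' \in indep M
    & \sum_(f in B :\ e) c f + \sum_(f in Q) c f - \sum_(f in B1) c f
        <= \sum_(f in B') c f].
Proof.
move=> eA eB eD sQD sBD iAB iQ maxB1.
have eQ : e \notin Q by apply: contra eD; apply/subsetP.
have [ieQ|deQ] := boolP (e |: Q \in indep M).
  exists (B :\ e); split=> //.
    by apply: indep_sub iAB (setUS _ _); exact: subsetDl.
  by rewrite -addrA gerDl subr_le0 maxB1.
have eAB : e \in A :|: B by rewrite inE eB orbT.
have [q [qQ qAB iqAB ieQq]] := indep_symmetric_exchange iAB iQ eAB eQ deQ.
have qe : q != e by apply: contraNneq eQ => <-.
have sub_qB : q |: (B :\ e) \subset D.
  by rewrite subUset sBD andbT sub1set (subsetP sQD).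
exists (q |: (B :\ e)); split=> //.
  apply: indep_sub iqAB _; apply/subsetP => z; rewrite !inE.
  case: (eqVneq z e) => [->|_]; last by case: (z == q); case: (z \in A).
  by rewrite (negPf eA) /= orbF.
have qB : q \notin B by apply: contra qAB => qB; rewrite inE qB orbT.
rewrite big_setU1 /=; last by rewrite inE (negPf qB) andbF.
have : \sum_(f in Q :\ q) c f <= \sum_(f in B1) c f.
  apply: maxB1; first exact: subset_trans (subsetDl _ _) sQD.
  apply: indep_sub ieQq _; apply/subsetP => z; rewrite !inE.
  by case: (eqVneq z e) => [->|_]; rewrite // eq_sym qe.
rewrite (big_setD1 q qQ) /=.
move: (\sum_(f in Q :\ q) c f) (\sum_(f in B1) c f) (\sum_(f in B :\ e) c f) => x y z.
by clear; move: (c q) => t; lra.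
Qed.

End WeightedExchange.

(** * Extreme optima of linear programs *)

Section ExtremeMaximizer.
Variable R : realType.

Lemma continuous_sum_coord n (C : 'I_n -> R) (h : R -> R) : continuous h ->
  continuous (fun v : 'rV[R]_n => \sum_i C i * h (v ord0 i)).
Proof.
move=> ch; apply: continuous_big => [x|i _ v].
  exact: add_continuous.
apply: (@continuousM _ _ (fun=> C i) (fun v : 'rV[R]_n => h (v ord0 i))).
  exact: cst_continuous.
apply: continuous_comp; [exact: coord_continuous|exact: ch].
Qed.

(** Among the maximizers of the linear form, one that maximizes the sum of
    squares is extreme: a segment centred at it lies in the face of maximizers,
    and the strictly convex sum of squares would increase towards one of its
    ends. *)
Lemma compact_extreme_maximizer n (A : set 'rV[R]_n) (C : 'I_n -> R) :
  (A !=set0)%classic -> compact A ->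
  exists v, [/\ A v,
    forall u, A u -> \sum_i C i * u ord0 i <= \sum_i C i * v ord0 i
    & forall d, A (v + d) -> A (v - d) -> d = 0].
Proof.
move=> A0 cA.
pose f (v : 'rV[R]_n) := \sum_i C i * v ord0 i.
pose g (v : 'rV[R]_n) := \sum_i 1 * (v ord0 i * v ord0 i).
have cf : continuous f by apply: (@continuous_sum_coord n C id) => x; exact: cvg_id.
have cg : continuous g.
  apply: (@continuous_sum_coord n (fun=> 1) (fun x => x * x)) => x.
  by apply: (@continuousM _ _ id id); exact: cvg_id.
have [u uA maxu] := compact_EVT_max A0 cA (continuous_subspaceT cf).
pose B := (A `&` [set v | f v = f u])%classic.
have cB : compact B.
  apply: compact_closedI => //.
  apply: (@preimage_closed _ _ f [set y | y = f u]%classic); last exact: closed_eq.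
  by move=> x _; exact: cf.
have B0 : (B !=set0)%classic by exists u; split=> //; exact: set_mem.
have [v vB maxv] := compact_EVT_max B0 cB (continuous_subspaceT cg).
move: vB; rewrite in_setE => -[vA fv].
exists v; split=> // [t tA|d Avd Avd'].
  by rewrite -/(f t) -/(f v) fv maxu ?in_setE.
have fD x y : f (x + y) = f x + f y.
  by rewrite /f -big_split; apply: eq_bigr => i _; rewrite mxE mulrDr.
have fN x : f (- x) = - f x.
  by rewrite /f -sumrN; apply: eq_bigr => i _; rewrite mxE mulrN.
have fd0 : f d = 0.
  have h1 := maxu (v + d); have h2 := maxu (v - d).
  move: h1 h2; rewrite !in_setE !fD fN fv => /(_ Avd) h1 /(_ Avd') h2.
  by apply/eqP; rewrite eq_le; apply/andP; split; lra.
have := maxv (v + d); have := maxv (v - d); rewrite !in_setE.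
move=> /(_ (conj Avd' _)) h2 /(_ (conj Avd _)) h1.
have {}h1 : g (v + d) <= g v by apply: h1; rewrite /= fD fd0 addr0.
have {}h2 : g (v - d) <= g v by apply: h2; rewrite /= fD fN fd0 oppr0 addr0.
have gE : g (v + d) + g (v - d) = 2 * g v + 2 * g d.
  rewrite /g -big_split !big_distrr -big_split /=; apply: eq_bigr => i _.
  by rewrite !mxE; ring.
have gd0 : g d <= 0 by lra.
apply/matrixP => i j; rewrite (ord1 i) mxE.
have /eqP : g d = 0.
  apply/eqP; rewrite eq_le gd0 /g sumr_ge0 // => k _.
  by rewrite mul1r -expr2 sqr_ge0.
rewrite /g psumr_eq0; last by move=> k _; rewrite mul1r -expr2 sqr_ge0.
by move=> /allP /(_ j (mem_index_enum _)); rewrite mul1r -expr2 sqrf_eq0 => /eqP.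
Qed.

(** A pair [(a, b)] of [cons] stands for the inequality [a . v <= b]. *)
Definition cube_polytope (V : finType) (cons : set ((V -> R) * R)) : set (V -> R) :=
  [set v | (forall s, 0 <= v s <= 1) /\
     (forall a b, cons (a, b) -> \sum_s a s * v s <= b)]%classic.

Lemma extreme_maximizer (V : finType) (cons : set ((V -> R) * R)) (C v0 : V -> R) :
  cube_polytope cons v0 ->
  exists v, [/\ cube_polytope cons v,
    forall u, cube_polytope cons u -> \sum_s C s * u s <= \sum_s C s * v s
    & forall d, cube_polytope cons (fun s => v s + d s) ->
                cube_polytope cons (fun s => v s - d s) -> forall s, d s = 0].
Proof.
move=> P0.
pose row (v : V -> R) : 'rV[R]_#|V| := \row_i v (enum_val i).
pose fn (x : 'rV[R]_#|V|) : V -> R := fun s => x ord0 (enum_rank s).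
have rowK v : fn (row v) = v.
  by apply/funext => s; rewrite /fn mxE enum_rankK.
have sumE (a : V -> R) x : \sum_s a s * fn x s = \sum_i a (enum_val i) * x ord0 i.
  rewrite (reindex (enum_val : 'I_#|V| -> V)) /=; last first.
    by apply: onW_bij; exact: enum_val_bij.
  by apply: eq_bigr => i _; rewrite /fn enum_valK.
pose A := [set x | cube_polytope cons (fn x)]%classic.
have cA : compact A.
  pose box := [set x : 'rV[R]_#|V| |
    forall i, (`[0, 1]%classic : set R) (x ord0 i)]%classic.
  pose form (q : (V -> R) * R) (x : 'rV[R]_#|V|) :=
    \sum_i q.1 (enum_val i) * x ord0 i.
  pose K := [set x | forall q, cons q -> form q x <= q.2]%classic.
  have -> : A = (box `&` K)%classic.
    apply/seteqP; split=> x /= [h1 h2]; split=> //.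
    - move=> i; have := h1 (enum_val i); rewrite /fn enum_valK /=.
      by rewrite in_itv.
    - by move=> [a b] /h2; rewrite sumE.
    - by move=> s; have := h1 (enum_rank s); rewrite /= in_itv.
    - by move=> a b /h2; rewrite sumE.
  apply: compact_closedI.
    apply: (@rV_compact R _ (fun=> `[0, 1]%classic)) => i; exact: segment_compact.
  have -> : K = (\bigcap_(q in cons) [set x | (form q x <= q.2)%R])%classic by [].
  apply: closed_bigI => q _.
  apply: (@preimage_closed _ _ (form q) [set y | y <= q.2]%classic).
    move=> y _; have idc : continuous (id : R -> R) by move=> z; exact: cvg_id.
    exact: (@continuous_sum_coord _ (fun i => q.1 (enum_val i)) id idc y).
  exact: closed_le.
have A0 : (A !=set0)%classic by exists (row v0); rewrite /A /= rowK.
have [x [Ax maxx extx]] := compact_extreme_maximizer (fun i => C (enum_val i)) A0 cA.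
exists (fn x); split=> // [u uP|d h1 h2 s].
  by rewrite -(rowK u) !sumE; apply: maxx; rewrite /A /= rowK.
have : row d = 0.
  apply: extx; rewrite /A /=.
  - by congr (cube_polytope cons _): h1; apply/funext => t; rewrite /fn !mxE enum_rankK.
  - by congr (cube_polytope cons _): h2; apply/funext => t; rewrite /fn !mxE enum_rankK.
by move=> /matrixP /(_ ord0 (enum_rank s)); rewrite !mxE enum_rankK.
Qed.

End ExtremeMaximizer.

(** * Tight rank constraints of one matroid *)

(** Fewer equations than unknowns. *)
Lemma exists_annihilated_direction (F : fieldType) (V K : finType)
    (D : {set V}) (W : {set K}) (a : K -> V -> F) : (#|W| < #|D|)%N ->
  exists d : V -> F, [/\ exists s, d s != 0, forall s, s \notin D -> d s = 0
    & forall k, k \in W -> \sum_s a k s * d s = 0].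
Proof.
move=> ltWD.
pose A : 'M[F]_(#|D|, #|W|) := \matrix_(i, j) a (enum_val j) (enum_val i).
pose v := nz_row (kermx A).
have v0 : v != 0.
  rewrite nz_row_eq0 -mxrank_eq0 mxrank_ker subn_eq0 -ltnNge.
  exact: leq_ltn_trans (rank_leq_col _) ltWD.
have vA : v *m A = 0 by apply/sub_kermxP; exact: nz_row_sub.
pose d (s : V) := \sum_(i < #|D|) (enum_val i == s)%:R * v 0 i.
have dE i : d (enum_val i) = v 0 i.
  rewrite /d (bigD1 i) //= eqxx mul1r big1 ?addr0 // => k ki.
  by rewrite (inj_eq enum_val_inj) (negPf ki) mul0r.
exists d; split.
- have /rV0Pn[i vi] := v0; by exists (enum_val i); rewrite dE.
- move=> s sD; rewrite /d big1 // => i _; case: eqP => [es|_]; last by rewrite mul0r.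
  by case/negP: sD; rewrite -es enum_valP.
- move=> k kW; have := congr1 (fun B : 'rV_#|W| => B 0 (enum_rank_in kW k)) vA.
  rewrite !mxE => vAk; apply: etrans vAk; rewrite /d.
  under eq_bigr do rewrite big_distrr /=.
  rewrite exchange_big /=; apply: eq_bigr => i _.
  rewrite mxE enum_rankK_in // (bigD1 (enum_val i)) //= eqxx mul1r big1 ?addr0.
    by rewrite mulrC.
  by move=> s; rewrite eq_sym => /negPf->; rewrite mul0r mulr0.
Qed.

Lemma sum_pullback (R : pzRingType) (V T : finType) (S : {set T}) (g : T -> V)
    (v : V -> R) :
  \sum_(e in S) v (g e) = \sum_s (\sum_(e in S) (g e == s)%:R) * v s.
Proof.
under [RHS]eq_bigr do rewrite big_distrl /=.
rewrite exchange_big /=; apply: eq_bigr => e _.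
rewrite (bigD1 (g e)) //= eqxx mul1r big1 ?addr0 // => s.
by rewrite eq_sym => /negPf->; rewrite mul0r.
Qed.

Section TightClasses.
Variables (R : realFieldType) (T : finType) (M : matroid T) (y : T -> R).
Hypothesis y_ge0 : forall e, 0 <= y e.
Hypothesis y_le1 : forall e, y e <= 1.
Hypothesis y_rank : forall S : {set T}, S \subset ground M ->
  \sum_(e in S) y e <= (rank M S)%:R.
Implicit Types S : {set T}.

Let supp := [set e in ground M | 0 < y e]%SET.
(** Tight sets are taken inside the support, so that they determine the
    partition of the support used below; zeros could be added or removed
    without changing the mass of a set. *)
Definition tight S := (S \subset supp) && (\sum_(e in S) y e == (rank M S)%:R).

Lemma tight_sub S : tight S -> S \subset supp. Proof. by case/andP. Qed.

Lemma supp_ground : supp \subset ground M.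
Proof. by apply/subsetP => e; rewrite inE => /andP[]. Qed.

(** Uncrossing: submodularity of the rank leaves no slack. *)
Lemma tightUI S S' : tight S -> tight S' -> tight (S :|: S') /\ tight (S :&: S').
Proof.
move=> /andP[sS /eqP yS] /andP[sS' /eqP yS'].
have sU : S :|: S' \subset supp by rewrite subUset sS.
have sI : S :&: S' \subset supp by rewrite subIset // sS.
have yU := y_rank (subset_trans sU supp_ground).
have yI := y_rank (subset_trans sI supp_ground).
have yUI : \sum_(e in S :|: S') y e + \sum_(e in S :&: S') y e
    = \sum_(e in S) y e + \sum_(e in S') y e.
  rewrite (big_setID S) /= (setIidPr (subsetUl _ _)) setDUl setDv set0U.
  by rewrite [\sum_(e in S') y e](big_setID S) /= [S' :&: S]setIC addrAC addrA.
have := rank_submod M S S'; rewrite -(ler_nat R) !natrD -yS -yS' -yUI => rUI.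
by split; rewrite /tight ?sU ?sI /= eq_le ?yU ?yI /=; lra.
Qed.

(** Elements of value [1] are thereby classes of their own, so a class that
    contains a fractional element consists of fractional elements. *)
Lemma tight_set1 e : e \in ground M -> y e = 1 -> tight [set e]%SET.
Proof.
move=> eG ye; have sG : [set e]%SET \subset ground M by rewrite sub1set.
rewrite /tight sub1set inE eG ye ltr01 /= big_set1 ye.
have := y_rank sG; rewrite big_set1 ye => h.
by rewrite eq_le h -[leRHS]/(1%:R) ler_nat -(cards1 e) rank_le_card.
Qed.

Let tight_at e := [set S | tight S & e \in S]%SET.
Let G := [set e in ground M | (0 < y e < 1) && (tight_at e != finset.set0)]%SET.
(** Fractional elements that belong to the same tight sets; those in no tight
    set are left out. *)
Definition tight_classes := preim_partition tight_at G.

(** The class of [e] is the difference of two nested tight sets, the least one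
    that contains [e] and the largest one inside it that avoids [e], so its mass
    is a difference of ranks: a positive integer. *)
Lemma tight_class_mass D : D \in tight_classes -> 1 <= \sum_(e in D) y e.
Proof.
move=> /imsetP[e]; rewrite inE => /and3P[eM /andP[ye0 ye1] /set0Pn[S0]].
rewrite inE => /andP[tS0 eS0] ->.
(* C will be the least tight set that contains e *)
pose pC S := tight S && (e \in S).
have [C /andP[tC eC] minC] := @arg_minnP _ S0 pC (fun S => #|S|) (introT andP (conj tS0 eS0)).
have {}minC S : tight S -> e \in S -> C \subset S.
  move=> tS eS; have [_ tI] := tightUI tC tS.
  have /minC le : pC (C :&: S) by rewrite /pC tI inE eC eS.
  by apply/setIidPl/eqP; rewrite eqEcard subsetIl le.
(* H will be the largest tight subset of C that avoids e *)
pose pH S := [&& tight S, S \subset C & e \notin S].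
have t0 : tight finset.set0.
  rewrite /tight sub0set big_set0 eq_sym pnatr_eq0 -leqn0.
  by rewrite -(cards0 T) rank_le_card.
have pH0 : pH finset.set0 by rewrite /pH t0 sub0set inE.
have [H /and3P[tH sHC eH] maxH] := @arg_maxnP _ finset.set0 pH (fun S => #|S|) pH0.
have {}maxH S : tight S -> S \subset C -> e \notin S -> S \subset H.
  move=> tS sSC eS; have [tU _] := tightUI tH tS.
  have /maxH le : pH (H :|: S) by rewrite /pH tU subUset sHC sSC inE negb_or eH eS.
  have /eqP -> : H == H :|: S by rewrite eqEcard subsetUl; exact: le.
  exact: subsetUr.
have eqCH : [set f in G | tight_at e == tight_at f]%SET = C :\: H.
  apply/setP => f; rewrite !inE; apply/idP/idP.
    case/andP=> _ /eqP/setP eqef.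
    have := eqef C; have := eqef H; rewrite !inE tC tH eC (negPf eH) /=.
    by move=> <- <-.
  case/andP=> fH fC.
  have efE : tight_at e = tight_at f.
    apply/setP => S; rewrite !inE; have [tS|] //= := boolP (tight S).
    have [eS|eS] := boolP (e \in S); first by rewrite (subsetP (minC S tS eS)).
    apply/esym/negbTE; apply: contra fH => fS; have [_ tI] := tightUI tC tS.
    apply: (subsetP (maxH (C :&: S) tI (subsetIl _ _) _)); last by rewrite inE fC.
    by rewrite inE negb_and eS orbT.
  have /setIdP[fM yf0] := subsetP (tight_sub tC) _ fC.
  rewrite fM yf0 efE eqxx andbT /=.
  have -> : tight_at f != finset.set0 by apply/set0Pn; exists C; rewrite !inE tC.
  rewrite andbT lt_neqAle y_le1 andbT; apply/eqP => yf1.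
  have : [set f]%SET \in tight_at f by rewrite !inE eqxx andbT tight_set1.
  rewrite -efE !inE => /andP[_ /eqP ef].
  by move: ye1; rewrite ef yf1 ltxx.
rewrite eqCH.
have : 0 < \sum_(f in C :\: H) y f.
  rewrite (big_setD1 e) /=; last by rewrite inE eH eC.
  by rewrite ltr_wpDr // sumr_ge0.
have /eqP yC := proj2 (andP tC); have /eqP yH := proj2 (andP tH).
have : \sum_(f in C) y f = \sum_(f in C :&: H) y f + \sum_(f in C :\: H) y f.
  exact: big_setID.
rewrite (setIidPr sHC) yC yH => /(canLR (addKr _)) <-.
by rewrite addrC -natrB ?rank_mono // ltr0n ler1n.
Qed.

Lemma card_tight_classes :
  #|tight_classes|%:R <= \sum_(e in ground M | 0 < y e < 1) y e.
Proof.
have partP := preim_partitionP tight_at G.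
rewrite -sumr_const.
apply: (@le_trans _ _ (\sum_(e in G) y e)).
  rewrite (set_partition_big _ partP) /=.
  by apply: ler_sum => D; exact: tight_class_mass.
rewrite [leLHS]big_mkcond [leRHS]big_mkcond /=; apply: ler_sum => e _.
rewrite inE; case: (e \in ground M) => //=; case: ifP => [/andP[-> _]//|_].
by case: ifP.
Qed.

(** On its support, a tight set meets the fractional elements in a union of
    classes.  Hence a direction that sums to zero on every class preserves all
    tight constraints. *)
Lemma tight_annihilated (d : T -> R) S :
  (forall e, ~~ (0 < y e < 1) -> d e = 0) ->
  (forall D, D \in tight_classes -> \sum_(e in D) d e = 0) ->
  S \subset ground M -> \sum_(e in S) y e = (rank M S)%:R ->
  \sum_(e in S) d e = 0.
Proof.
move=> d0 dD sS yS.
pose S' := S :&: supp.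
have sum_supp (z : T -> R) : (forall e, e \notin supp -> e \in ground M -> z e = 0) ->
    \sum_(e in S) z e = \sum_(e in S') z e.
  move=> z0; rewrite (big_setID supp) /= [X in _ + X]big1 ?addr0 // => e.
  by case/setDP => eS es; rewrite z0 // (subsetP sS).
have y0 e : e \notin supp -> e \in ground M -> y e = 0.
  by rewrite inE negb_and => /orP[/negbTE->//|]; rewrite -leNgt => h _; apply/eqP; rewrite eq_le h y_ge0.
have tS' : tight S'.
  have rS' : (rank M S' <= rank M S)%N by rewrite rank_mono ?subsetIl.
  rewrite /tight subsetIr -(sum_supp y y0) yS eq_le !ler_nat rS' andbT /=.
  by rewrite -(ler_nat R) -yS (sum_supp y y0) y_rank // (subset_trans (subsetIl _ _) sS).
rewrite sum_supp; last by move=> e es eM; rewrite d0 // y0 // ltxx.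
have partP := preim_partitionP tight_at G.
have -> : \sum_(e in S') d e = \sum_(e in G | e \in S') d e.
  rewrite [LHS]big_mkcond [RHS]big_mkcond /=; apply: eq_bigr => e _.
  have [eS'|] := boolP (e \in S'); rewrite ?andbF // andbT.
  case: ifP => // /negbT eG; apply: d0; apply: contra eG => ye.
  rewrite inE ye (subsetP sS) /=; last by move: eS'; rewrite inE => /andP[].
  by apply/set0Pn; exists S'; rewrite inE tS'.
rewrite (set_partition_big_cond _ partP) big1 // => D DP.
have [f fE] : exists2 f, f \in G & D = [set g in G | tight_at f == tight_at g]%SET.
  by case/imsetP: DP => f fG ->; exists f.
move=> DE.
have memS g : g \in D -> (g \in S') = (f \in S').
  by rewrite DE inE => /andP[_ /eqP/setP/(_ S')]; rewrite !inE tS' /= => ->.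
have [fS|fS] := boolP (f \in S').
  rewrite -[RHS](dD D DP); apply: eq_bigl => g.
  by have [gD|//] := boolP (g \in D); rewrite memS.
by rewrite big_pred0 // => g; have [gD|//] := boolP (g \in D); rewrite memS ?(negPf fS).
Qed.

End TightClasses.

(** * Extreme points of the relaxation with local elements *)

(** A direction that respects the tight constraints can be followed in both
    senses for a positive time. *)
Lemma exists_small_step (R : realFieldType) (I : finType) (slack del : I -> R) :
  (forall i, 0 <= slack i) -> (forall i, slack i = 0 -> del i = 0) ->
  exists2 t, 0 < t & forall i, `|t * del i| <= slack i.
Proof.
move=> slack_ge0 del0.
suff [t t0 ht] : exists2 t, 0 < t & forall i, i \in enum I -> `|t * del i| <= slack i.
  by exists t => // i; rewrite ht ?mem_enum.
elim: (enum I) => [|i s [t t0 IH]]; first by exists 1.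
have [s0|s0] := eqVneq (slack i) 0.
  exists t => // k; rewrite inE => /orP[/eqP ->|/IH //].
  by rewrite del0 // mulr0 normr0.
have spos : 0 < slack i by rewrite lt_neqAle eq_sym s0 slack_ge0.
have dpos : 0 < 1 + `|del i| by rewrite ltr_wpDr.
pose u := slack i / (1 + `|del i|).
have u0 : 0 < u by rewrite divr_gt0.
exists (Num.min t u); first by rewrite lt_min t0 u0.
have m0 : 0 <= Num.min t u by rewrite le_min !ltW.
move=> k; rewrite inE normrM (ger0_norm m0) => /orP[/eqP ->|ks].
  apply: (@le_trans _ _ (u * `|del i|)); first by rewrite ler_wpM2r // ge_min lexx orbT.
  by rewrite /u mulrAC ler_pdivrMr // ler_pM2l // lerDr.
apply: le_trans (IH k ks); rewrite normrM (gtr0_norm t0) ler_wpM2r //.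
by rewrite ge_min lexx.
Qed.

Section Relaxation.
Variables (R : realType) (T : finType) (m : nat) (M : 'I_m -> matroid T).
Implicit Types (X S : {set T}) (v : T + 'I_m * T -> R).

(** With [X] the set of elements that are still global, the variable that
    matroid [j] sees at [e]: [inl e] is shared by all matroids, [inr (j, e)] is
    the private copy of a deleted element. *)
Definition copy_var X (j : 'I_m) (e : T) : T + 'I_m * T :=
  if e \in X then inl e else inr (j, e).

(** The natural linear program once the elements outside [X] have been split
    into private copies.  Coordinates that no matroid sees are only required to
    lie in [[0, 1]]. *)
Definition relaxation X v : Prop :=
  (forall s, 0 <= v s <= 1) /\
  forall j S, S \subset ground (M j) ->
    \sum_(e in S) v (copy_var X j e) <= (rank (M j) S)%:R.

Lemma relaxation_extreme_maximizer X (C v0 : T + 'I_m * T -> R) :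
  relaxation X v0 ->
  exists v, [/\ relaxation X v,
    forall u, relaxation X u -> \sum_s C s * u s <= \sum_s C s * v s
    & forall d, relaxation X (fun s => v s + d s) ->
                relaxation X (fun s => v s - d s) -> forall s, d s = 0].
Proof.
pose cons := [set q : (T + 'I_m * T -> R) * R | exists j S, S \subset ground (M j) /\
   q = (fun s => \sum_(e in S) (copy_var X j e == s)%:R, (rank (M j) S)%:R)]%classic.
have consE v : relaxation X v <-> cube_polytope cons v.
  split=> -[box h]; split=> //.
    by move=> a b [j [S [sS [-> ->]]]]; rewrite -sum_pullback h.
  by move=> j S sS; rewrite (sum_pullback S) h //; exists j, S.
move=> /consE/(extreme_maximizer C) [v [/consE Pv maxv extv]].
by exists v; split=> // [u /consE /maxv //|d /consE h1 /consE h2]; exact: extv.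
Qed.

(** If some coordinate [s] were fractional, count the tight classes of all
    matroids against the fractional coordinates.  A class has mass at least [1],
    and [s] contributes to at most [N s] classes, with [N s * v s < 1]: [N s] is
    at most [p] for a global coordinate, and at most [1] for a local one.  So
    there are fewer classes than fractional coordinates, and some direction
    preserves all tight constraints, against extremality. *)
Lemma extreme_integral (p : nat) X v :
  (forall e : T, (#|[set j : 'I_m | e \in ground (M j)]| <= p)%N) ->
  relaxation X v ->
  (forall d, relaxation X (fun s => v s + d s) ->
             relaxation X (fun s => v s - d s) -> forall s, d s = 0) ->
  (forall e, e \in X -> p%:R * v (inl e) < 1) ->
  forall s, v s = 0 \/ v s = 1.
Proof.
move=> degp [box rk] extv small.
pose F : {set T + 'I_m * T} := [set s | 0 < v s < 1].
have vF s : s \notin F -> v s = 0 \/ v s = 1.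
  have /andP[v0 v1] := box s; rewrite inE negb_and -!leNgt => /orP[h|h].
    by left; apply/eqP; rewrite eq_le h v0.
  by right; apply/eqP; rewrite eq_le h v1.
have [F0|[s0 s0F]] := set_0Vmem F.
  by move=> s; apply: vF; rewrite F0 inE.
pose y j e := v (copy_var X j e).
have y0 j e : 0 <= y j e by case/andP: (box (copy_var X j e)).
have y1 j e : y j e <= 1 by case/andP: (box (copy_var X j e)).
pose P j := tight_classes (M j) (y j).
pose W := [set k : 'I_m * {set T} | k.2 \in P k.1].
have cardW : #|W| = (\sum_j #|P j|)%N.
  rewrite -sum1_card; under [RHS]eq_bigr do rewrite -sum1_card.
  by rewrite pair_big_dep; apply: eq_bigl => k; rewrite inE.
pose N (s : T + 'I_m * T) :=
  #|[set q : 'I_m * T | (q.2 \in ground (M q.1)) && (copy_var X q.1 q.2 == s)]|.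
have Nv s : s \in F -> (N s)%:R * v s < 1.
  rewrite inE => /andP[vs0 vs1].
  case: s vs0 vs1 => [e|[j e]] vs0 vs1.
    have [eX|eX] := boolP (e \in X).
      apply: le_lt_trans (small e eX); rewrite ler_pM2r // ler_nat.
      apply: leq_trans (degp e).
      rewrite -(card_imset _ (_ : injective (fun j : 'I_m => (j, e)))); last by move=> j k [].
      apply: subset_leq_card; apply/subsetP => -[j f]; rewrite inE /= /copy_var.
      case: ifP => _ /andP[fj /eqP //] [fe].
      by apply/imsetP; exists j; rewrite ?inE -?fe.
    suff -> : N (inl e) = 0%N by rewrite mul0r ltr01.
    apply: eq_card0 => -[j f]; rewrite !inE /= /copy_var.
    case: ifP => [fX|_]; last by rewrite andbF.
    by apply/negbTE/negP => /andP[_ /eqP[fe]]; rewrite -fe fX in eX.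
  suff N1 : (N (inr (j, e)) <= 1)%N.
    apply: le_lt_trans vs1; rewrite -[leRHS]mul1r ler_pM2r //.
    by rewrite (ler_nat R _ 1).
  rewrite -(cards1 (j, e)); apply: subset_leq_card; apply/subsetP => -[k f].
  by rewrite !inE /= /copy_var; case: ifP => _ /andP[_ /eqP // [-> ->]].
have ltWF : (#|W| < #|F|)%N.
  rewrite -(ltr_nat R) cardW natr_sum.
  apply: (@le_lt_trans _ _ (\sum_(s in F) (N s)%:R * v s)); last first.
    rewrite -sumr_const (bigD1 s0) //= [ltRHS](bigD1 s0) //= ltr_leD ?Nv //.
    by apply: ler_sum => s /andP[sF _]; rewrite ltW ?Nv.
  apply: (@le_trans _ _ (\sum_j \sum_(e in ground (M j) | 0 < y j e < 1) y j e)).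
    apply: ler_sum => j _; apply: card_tight_classes => // S; exact: rk.
  rewrite pair_big_dep /= (partition_big (fun q => copy_var X q.1 q.2) (mem F)) /=; last first.
    by move=> q /andP[_ h]; rewrite inE.
  apply: ler_sum => s sF.
  rewrite (eq_bigr (fun=> v s)); last by move=> q /andP[_ /eqP <-].
  rewrite sumr_const -[leLHS]mulr_natl ler_wpM2r //; first by case/andP: (box s).
  rewrite ler_nat; apply: subset_leq_card; apply/subsetP => q.
  by rewrite !inE => /andP[/andP[-> _] ->].
have [d [[s1 ds1] dF dW]] := exists_annihilated_direction
  (fun (k : 'I_m * {set T}) s => \sum_(e in k.2) (copy_var X k.1 e == s)%:R : R) ltWF.
have dtight j S : S \subset ground (M j) -> \sum_(e in S) y j e = (rank (M j) S)%:R ->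
    \sum_(e in S) d (copy_var X j e) = 0.
  move=> sS yS.
  apply: (@tight_annihilated _ _ (M j) (y j) (y0 j) (rk j) (fun e => d (copy_var X j e)) S) => //.
    by move=> e ye; apply: dF; rewrite inE.
  by move=> D DP; rewrite (sum_pullback D); apply: (dW (j, D)); rewrite inE.
(* v * (1 - v) is a slack for both bounds 0 <= v <= 1 at once *)
pose slack (i : (T + 'I_m * T) + 'I_m * {set T}) := match i with
  | inl s => v s * (1 - v s)
  | inr (j, U) => (rank (M j) (U :&: ground (M j)))%:R
                  - \sum_(e in U :&: ground (M j)) y j e end.
pose del (i : (T + 'I_m * T) + 'I_m * {set T}) := match i with
  | inl s => d s
  | inr (j, U) => \sum_(e in U :&: ground (M j)) d (copy_var X j e) end.
have [t t0 ht] : exists2 t, 0 < t & forall i, `|t * del i| <= slack i.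
  apply: exists_small_step => [[s|[j S]]|[s|[j S]]] /=.
  - by have /andP[h1 h2] := box s; rewrite mulr_ge0 // subr_ge0.
  - by rewrite subr_ge0 rk ?subsetIr.
  - move=> /eqP h; apply: dF; rewrite inE; apply: contraL h => /andP[h1 h2].
    by rewrite mulf_neq0 // ?gt_eqF // subr_gt0.
  - move=> /eqP; rewrite subr_eq0 eq_sym => /eqP; apply: dtight; exact: subsetIr.
have feas (b : R) : `|b| = 1 -> relaxation X (fun s => v s + b * (t * d s)).
  move=> b1; have normb z : `|b * z| = `|z| by rewrite normrM b1 mul1r.
  split=> [s|j S sS].
    have := ht (inl s); rewrite -normb ler_norml /= => /andP[h1 h2].
    have /andP[h3 h4] := box s.
    have h5 : v s * (1 - v s) <= v s by rewrite ler_piMr // gerBl.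
    have h6 : v s * (1 - v s) <= 1 - v s by rewrite ler_piMl // subr_ge0.
    rewrite -lerBlDl sub0r -lerBrDl (le_trans h2 h6) andbT.
    by apply: le_trans h1; rewrite lerN2.
  rewrite big_split /= -!mulr_sumr.
  have := ht (inr (j, S)); rewrite /= (setIidPl sS) -normb ler_norml.
  by case/andP=> _; rewrite lerBrDl.
have fp := feas 1 (normr1 _); have fm := feas (-1) (normrN1 _).
have d0 : t * d s1 = 0.
  apply: (extv (fun s => t * d s)).
    by congr (relaxation X _): fp; apply/funext => s; rewrite mul1r.
  by congr (relaxation X _): fm; apply/funext => s; rewrite mulN1r.
by move/eqP: d0; rewrite mulf_eq0 (gt_eqF t0) (negPf ds1).
Qed.

End Relaxation.

(** * Rounding by deletion and reinsertion *)

Section Rounding.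
Variables (R : realType) (T : finType) (m : nat) (M : 'I_m -> matroid T).
Implicit Types (X I : {set T}) (v : T + 'I_m * T -> R) (w : T -> R)
  (c : 'I_m -> T -> R) (B : 'I_m -> {set T}) (k : 'I_m -> R).

Definition lp_value X w c v : R :=
  \sum_(e in X) w e * v (inl e)
  + \sum_j \sum_(e in ground (M j) :\: X) c j e * v (inr (j, e)).

Definition local_weight c B : R := \sum_j \sum_(e in B j) c j e.

(** An integral solution of the split program: [B j] consists of private copies
    held by matroid [j]. *)
Definition rounding X I B :=
  [/\ I \subset X, forall j, B j \subset ~: X
    & forall j, (I :&: ground (M j)) :|: B j \in indep (M j)].

(** Splitting [e] costs a bounded loss when [e] is put back, and the second term
    of the bound pays for it: it measures how much [e] adds to the free local
    sets [B0]. *)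
Definition has_rounding (a : R) X w c v B0 := exists I B, rounding X I B /\
  a^-1 * lp_value X w c v + (1 - a^-1) * local_weight c B0
    <= \sum_(e in I) w e + local_weight c B.

Definition roundable (a : R) X := forall w c v B0,
  relaxation M X v -> (forall j, B0 j \subset ~: X) ->
  (forall j, B0 j \in indep (M j)) -> has_rounding a X w c v B0.

(** Weights and fractional point after [e] has been split: the new copy in
    matroid [j] has weight [k j] and inherits the value of [e]. *)
Definition set_local_weight e c k : 'I_m -> T -> R :=
  fun j f => if f == e then k j else c j f.

Definition localize e v : T + 'I_m * T -> R :=
  fun s => if s is inr (j, f) then if f == e then v (inl e) else v s else v s.

Lemma localize_relaxation X e v : e \in X ->
  relaxation M X v -> relaxation M (X :\ e) (localize e v).
Proof.
move=> eX [box rk]; split=> [[f|[j f]]|j U sU]; rewrite /localize ?box //.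
  by case: ifP; rewrite box.
apply: le_trans (rk j U sU); rewrite le_eqVlt; apply/orP; left; apply/eqP.
apply: eq_bigr => f _; rewrite /copy_var !inE; case: (eqVneq f e) => [->|fe] /=.
  by rewrite eX eqxx.
by case: ifP; rewrite ?(negPf fe).
Qed.

Lemma sum_set_local_weight e c k j (U : {set T}) :
  \sum_(f in U) set_local_weight e c k j f
    = \sum_(f in U :\ e) c j f + (if e \in U then k j else 0).
Proof.
have eqD : \sum_(f in U :\ e) set_local_weight e c k j f = \sum_(f in U :\ e) c j f.
  by apply: eq_bigr => f; rewrite !inE /set_local_weight => /andP[/negPf-> _].
case: ifP => eU; last first.
  by rewrite addr0 -eqD; apply: eq_bigl => f; rewrite !inE; case: eqP => // ->.
by rewrite (big_setD1 e) //= eqD {1}/set_local_weight eqxx addrC.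
Qed.

Lemma local_weight_set e c k B :
  local_weight (set_local_weight e c k) B
    = local_weight c (fun j => B j :\ e) + \sum_(j | e \in B j) k j.
Proof.
rewrite /local_weight [X in _ + X]big_mkcond -big_split /=.
by apply: eq_bigr => j _; rewrite sum_set_local_weight.
Qed.

Lemma lp_value_localize X e w c k v : e \in X ->
  lp_value (X :\ e) w (set_local_weight e c k) (localize e v)
    = lp_value X w c v
      + v (inl e) * (\sum_(j | e \in ground (M j)) k j - w e).
Proof.
move=> eX; rewrite /lp_value [\sum_(f in X) _](big_setD1 e) //=.
have -> : \sum_j \sum_(f in ground (M j) :\: (X :\ e))
        set_local_weight e c k j f * localize e v (inr (j, f))
    = \sum_j \sum_(f in ground (M j) :\: X) c j f * v (inr (j, f))
      + \sum_(j | e \in ground (M j)) k j * v (inl e).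
  rewrite [X in _ = _ + X]big_mkcond -big_split /=; apply: eq_bigr => j _.
  have eqD : \sum_(f in ground (M j) :\: X)
      set_local_weight e c k j f * localize e v (inr (j, f))
      = \sum_(f in ground (M j) :\: X) c j f * v (inr (j, f)).
    apply: eq_bigr => f; rewrite inE /set_local_weight /localize.
    by case: (eqVneq f e) => [->|//]; rewrite eX.
  have [eE|eE] := boolP (e \in ground (M j)); last first.
    rewrite addr0 -eqD; apply: eq_bigl => f; rewrite !inE.
    by case: (eqVneq f e) => [->|//]; rewrite (negPf eE) !andbF.
  have -> : ground (M j) :\: (X :\ e) = e |: (ground (M j) :\: X).
    by apply/setP => f; rewrite !inE; case: (eqVneq f e) => [->|//]; rewrite eE.
  rewrite big_setU1 ?inE ?eX //= eqD addrC.
  by rewrite /set_local_weight /localize eqxx.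
rewrite -mulr_suml; move: (\sum_(j | _) _) (\sum_j _) (\sum_(f in _) _) => x y z.
by move: (v _) (w e) => s t; ring.
Qed.

(** An element of value [0] contributes nothing: it is split into copies of
    weight [0], which are dropped afterwards. *)
Lemma roundable_zero a X e : e \in X -> roundable a (X :\ e) ->
  forall w c v B0, v (inl e) = 0 ->
  relaxation M X v -> (forall j, B0 j \subset ~: X) ->
  (forall j, B0 j \in indep (M j)) -> has_rounding a X w c v B0.
Proof.
move=> eX rX w c v B0 ve relv sB0 iB0.
have sXe : X :\ e \subset X by exact: subsetDl.
have [|//|I [B [[sI sB iB] le]]] :=
  rX w (set_local_weight e c (fun=> 0)) _ B0 (localize_relaxation eX relv).
  by move=> j; rewrite (subset_trans (sB0 j)) ?setCS.
exists I, (fun j => B j :\ e); split.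
  split=> [|j|j]; first exact: subset_trans sI sXe.
    apply/subsetP => f; rewrite !inE => /andP[fe fB].
    by have := subsetP (sB j) f fB; rewrite !inE fe.
  by apply: indep_sub (iB j) (setUS _ _); exact: subsetDl.
move: le; rewrite lp_value_localize // ve mul0r addr0 !local_weight_set.
have sum0 (P : pred 'I_m) : \sum_(j | P j) (fun=> 0 : R) j = 0 by rewrite big1.
rewrite !sum0 !addr0.
suff -> : local_weight c (fun j => B0 j :\ e) = local_weight c B0 by [].
apply: eq_bigr => j _; apply: eq_bigl => f; rewrite !inE.
have [->|//] := eqVneq f e.
by apply/esym/negbTE; apply: contraL eX => /(subsetP (sB0 j)); rewrite inE.
Qed.

(** Once all elements are split, an integral point is itself a solution, because
    its support in each matroid is as large as its rank; the bound is a convex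
    combination of the weights of that solution and of [B0]. *)
Lemma integral_rounding a c v B0 : 1 <= a ->
  (forall s, v s = 0 \/ v s = 1) ->
  relaxation M finset.set0 v ->
  (forall j, B0 j \in indep (M j)) ->
  forall w, has_rounding a finset.set0 w c v B0.
Proof.
move=> a1 int [box rk] iB0 w; rewrite /has_rounding.
pose B1 j := [set f in ground (M j) | v (inr (j, f)) == 1].
have iB1 j : B1 j \in indep (M j).
  have sB : B1 j \subset ground (M j) by apply/subsetP => f; rewrite inE => /andP[].
  apply: indep_of_rank; rewrite -(ler_nat R); apply: le_trans (rk j _ sB).
  rewrite -sumr_const; apply: ler_sum => f; rewrite !inE /copy_var inE => /andP[_ /eqP->].
  exact: lexx.
have lpE : lp_value finset.set0 w c v = local_weight c B1.
  rewrite /lp_value big_set0 add0r; apply: eq_bigr => j _.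
  rewrite setD0 [LHS]big_mkcond [RHS]big_mkcond /=; apply: eq_bigr => f _.
  rewrite inE; case: (f \in ground (M j)) => //=.
  by case: (int (inr (j, f))) => ->; rewrite ?eqxx ?mulr1 // eq_sym oner_eq0 mulr0.
have rounding0 B : (forall j, B j \in indep (M j)) -> rounding finset.set0 finset.set0 B.
  move=> iB; split=> [|j|j]; rewrite ?sub0set ?setC0 ?subsetT //.
  by rewrite set0I set0U.
have a0 : 0 < a by apply: lt_le_trans a1.
have ia0 : 0 <= a^-1 by rewrite invr_ge0 ltW.
have ia1 : 0 <= 1 - a^-1 by rewrite subr_ge0 invf_le1.
rewrite lpE; have [le|/ltW le] := leP (local_weight c B0) (local_weight c B1).
  exists finset.set0, B1; split; first exact: rounding0.
  rewrite big_set0 add0r; move: (local_weight c B0) (local_weight c B1) le => x y le.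
  by have := ler_wpM2l ia1 le; move: (a^-1) => b; clear; lra.
exists finset.set0, B0; split; first exact: rounding0.
rewrite big_set0 add0r; move: (local_weight c B0) (local_weight c B1) le => x y le.
by have := ler_wpM2l ia0 le; move: (a^-1) => b; clear; lra.
Qed.

(** Equivalent to [q - (q - 1) * x <= a]; the left side is largest at [x = 1/p]
    and [q = p], where it equals [a]. *)
Lemma reinsertion_gap (p q : nat) (x a : R) :
  a = p%:R - 1 + p%:R^-1 -> (1 <= q)%N -> (q <= p)%N ->
  1 <= p%:R * x ->
  q%:R - 1 <= a^-1 * (x * (q%:R - 1)) + (1 - a^-1) * q%:R.
Proof.
move=> aE q1 qp px.
have p0 : 0 < p%:R :> R by rewrite ltr0n (leq_trans q1).
have a0 : 0 < a.
  by rewrite aE ltr_wpDl ?invr_gt0 // subr_ge0 ler1n (leq_trans q1).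
have {}q1 : 0 <= q%:R - 1 :> R by rewrite subr_ge0 ler1n.
have qp' : q%:R <= p%:R :> R by rewrite ler_nat.
have xp : p%:R^-1 <= x by rewrite -[leLHS]mul1r ler_pdivrMr // mulrC.
have p1 : p%:R^-1 <= 1 :> R by rewrite invf_le1 // ler1n -(ltr_nat R).
have key : a * (q%:R - 1) <= x * (q%:R - 1) + (a - 1) * q%:R.
  have h1 := ler_wpM2r q1 xp.
  have h2 : 0 <= (p%:R - q%:R) * (1 - p%:R^-1) :> R by rewrite mulr_ge0 ?subr_ge0.
  have h3 : p%:R * p%:R^-1 = 1 :> R by rewrite mulfV ?gt_eqF.
  rewrite aE; move: (p%:R) (q%:R) (p%:R^-1) h1 h2 h3 => P Q I h1 h2 h3.
  by clear -h1 h2 h3; nra.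
rewrite -(ler_pM2l a0); apply: le_trans key _; rewrite le_eqVlt; apply/orP; left.
by apply/eqP; move: (q%:R) => Q; field; rewrite gt_eqF.
Qed.

(** Each matroid [j] that contains [e] receives a copy of weight [k j + b].
    Here [k j] is what [B0 j] loses when it makes room for [e], and [delta], the
    part of [w e] that exceeds the sum of the [k j], determines [b].
    If [delta >= 0], then [b = delta]: the free local sets gain [delta] in each
    of the [q] matroids when they adopt [e], while putting [e] back loses at
    most [(q - 1) * delta].  If [delta < 0], then [b = delta / q]: the copies
    together weigh exactly [w e], the free local sets keep away from [e], and
    nothing is lost. *)
Lemma roundable_reinsert (p : nat) X e :
  (forall f : T, (#|[set j : 'I_m | f \in ground (M j)]| <= p)%N) ->
  (exists j, e \in ground (M j)) ->
  e \in X -> roundable (p%:R - 1 + p%:R^-1) (X :\ e) ->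
  forall w c v B0, 1 <= p%:R * v (inl e) ->
  relaxation M X v -> (forall j, B0 j \subset ~: X) ->
  (forall j, B0 j \in indep (M j)) ->
  has_rounding (p%:R - 1 + p%:R^-1) X w c v B0.
Proof.
move=> degp [j0 ej0] eX rX w c v B0 pv relv sB0 iB0.
set a := p%:R - 1 + p%:R^-1.
pose J := [set j : 'I_m | e \in ground (M j)].
pose q := #|J|.
have q1 : (1 <= q)%N by apply/card_gt0P; exists j0; rewrite inE.
have qp : (q <= p)%N by exact: degp.
have eCX : e \notin ~: X by rewrite inE eX.
have eB0 j : e \notin B0 j by apply: contra eCX; exact: (subsetP (sB0 j)).
have v_gt0 : 0 < v (inl e).
  have p0 : 0 <= p%:R :> R by [].
  rewrite ltNge; apply/negP => v0; have := le_trans pv (mulr_ge0_le0 p0 v0).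
  by rewrite ler10.
have e_indep j : e \in ground (M j) -> [set e] \in indep (M j).
  move=> eE; apply: indep_of_rank; rewrite cards1.
  have sE : [set e] \subset ground (M j) by rewrite sub1set.
  have := proj2 relv j _ sE; rewrite big_set1 /copy_var eX => le.
  by rewrite -(ltr_nat R) (lt_le_trans v_gt0).
have /fin_all_exists[B1 B1P] : forall j, exists U : {set T}, e \in ground (M j) ->
    [/\ U \subset ~: X, e |: U \in indep (M j) & forall U0 : {set T}, U0 \subset ~: X ->
      e |: U0 \in indep (M j) -> \sum_(f in U0) c j f <= \sum_(f in U) c j f].
  move=> j; have [eE|] := boolP (e \in ground (M j)); last by exists finset.set0.
  pose ok (U : {set T}) := (U \subset ~: X) && (e |: U \in indep (M j)).
  have ok0 : ok finset.set0 by rewrite /ok sub0set setU0 e_indep.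
  have [U /andP[sU iU] maxU] := @arg_maxP _ _ _ finset.set0 ok (fun U => \sum_(f in U) c j f) ok0.
  by exists U => _; split=> // U0 sU0 iU0; apply: maxU; rewrite /ok sU0.
pose k j := \sum_(f in B0 j) c j f - \sum_(f in B1 j) c j f.
pose delta := w e - \sum_(j in J) k j.
pose b := if 0 <= delta then delta else delta / q%:R.
pose k' j := k j + b.
pose c' := set_local_weight e c k'.
pose B0' j := if (0 <= delta) && (e \in ground (M j)) then e |: B1 j else B0 j.
pose loss := if 0 <= delta then (q%:R - 1) * delta else 0.
have q0 : 0 < q%:R :> R by rewrite ltr0n.
have sum_k' : \sum_(j in J) k' j - w e = loss.
  have -> : \sum_(j in J) k' j = \sum_(j in J) k j + q%:R * b.
    by rewrite big_split sumr_const mulr_natl.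
  have -> : w e = delta + \sum_(j in J) k j by rewrite subrK.
  rewrite /loss /b; generalize delta (\sum_(j in J) k j) => z x.
  case: ifP => _; first by ring.
  by rewrite mulrCA mulfV ?gt_eqF // mulr1; ring.
have [||I [B [[sI sB iB] le]]] := rX w c' _ B0' (localize_relaxation eX relv).
- move=> j; rewrite setCD setUC /B0'; case: ifP => [/andP[_ eE]|_].
    by rewrite setUS //; have [] := B1P j eE.
  by rewrite subsetU // sB0 orbT.
- move=> j; rewrite /B0'; case: ifP => [/andP[_ eE]|_]; last exact: iB0.
  by have [] := B1P j eE.
have eI : e \notin I by apply/negP => /(subsetP sI); rewrite setD11.
have sBe j : B j :\ e \subset ~: X.
  apply/subsetP => f; rewrite !inE => /andP[fe fB].
  by have := subsetP (sB j) f fB; rewrite !inE fe.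
have eBJ j : e \in B j -> j \in J.
  by move=> eB; rewrite inE; apply: (subsetP (indep_ground (iB j))); rewrite inE eB orbT.
(* the gain of the split program over the original one covers this loss *)
suff [I' [B' [rIB' leB']]] : exists I' B', rounding X I' B' /\
    \sum_(f in I) w f + local_weight c' B - loss
      <= \sum_(f in I') w f + local_weight c B'.
  exists I', B'; split=> //; apply: le_trans leB'.
  rewrite lerBrDr; apply: le_trans le.
  have -> : lp_value (X :\ e) w c' (localize e v) = lp_value X w c v + v (inl e) * loss.
    rewrite lp_value_localize //; congr (_ + _ * _); rewrite -sum_k'.
    by congr (_ - _); apply: eq_bigl => j; rewrite inE.
  have -> : local_weight c' B0'
      = local_weight c B0 + (if 0 <= delta then q%:R * delta else 0).
    rewrite local_weight_set /B0' /b; case: ifP => d0 /=.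
      rewrite mulr_natl -sumr_const [X in _ + X]big_mkcond [X in _ = _ + X]big_mkcond.
      rewrite /local_weight -!big_split /=; apply: eq_bigr => j _; rewrite inE.
      case: ifP => eE.
        rewrite setU11 setU1K; last first.
          by have [sU _ _] := B1P j eE; apply: contra eCX; exact: (subsetP sU).
        rewrite /k' /k /b d0; generalize delta => z.
        by move: (\sum_(f in B0 j) _) (\sum_(f in B1 j) _) => x y; ring.
      rewrite (negPf (eB0 j)) !addr0; apply: eq_bigl => f; rewrite !inE.
      by case: eqP => // ->; rewrite (negPf (eB0 j)).
    rewrite big1 ?addr0; last by move=> j; rewrite (negPf (eB0 j)).
    apply: eq_bigr => j _; apply: eq_bigl => f; rewrite !inE.
    by case: eqP => // ->; rewrite (negPf (eB0 j)).
  have := reinsertion_gap (erefl a) q1 qp pv; rewrite /loss.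
  move: (lp_value _ _ _ _) (local_weight _ _) (a^-1) (v _) (q%:R) => L W ia x Q gap.
  case: ifP => [d0|_]; last by rewrite !(mulr0, addr0).
  have := ler_wpM2r d0 gap; generalize delta => z.
  by move=> h; nra.
have [allB|/forallPn[j1]] := boolP [forall j, (j \in J) ==> (e \in B j)].
  have BJ j : (e \in B j) = (j \in J).
    by apply/idP/idP; [exact: eBJ|move/forallP: allB => /(_ j)/implyP].
  exists (e |: I), (fun j => B j :\ e); split; last first.
    rewrite big_setU1 //= local_weight_set (eq_bigl _ _ BJ) -sum_k'.
    move: (\sum_(j in J) _) (\sum_(f in I) _) (local_weight _ _) (w e); clear.
    by move=> x y z t; lra.
  split=> [|j|j]; first by rewrite subUset sub1set eX (subset_trans sI) // subsetDl.
    exact: sBe.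
  apply: indep_sub (iB j) _; apply/subsetP => f; rewrite !inE.
  have [->|//] := eqVneq f e; rewrite /= orbF => eE.
  by rewrite BJ inE eE orbT.
rewrite negb_imply => /andP[j1J eB1].
(* otherwise e stays out and is exchanged in each local set that holds it *)
have /fin_all_exists[B' B'P] : forall j, exists U : {set T},
    [/\ U \subset ~: X, (I :&: ground (M j)) :|: U \in indep (M j) &
     \sum_(f in B j) c' j f <= \sum_(f in U) c j f + (if e \in B j then b else 0)].
  move=> j; rewrite /c' sum_set_local_weight; case: ifP => eB; last first.
    exists (B j :\ e); split; [exact: sBe| |by rewrite !addr0].
    by apply: indep_sub (iB j) (setUS _ _); exact: subsetDl.
  have [|sB1 iB1 maxB1] := B1P j; first by have := eBJ j eB; rewrite inE.
  have eIE : e \notin I :&: ground (M j) by rewrite inE (negPf eI).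
  have [U [sU iU leU]] := local_exchange eIE eB eCX (sB0 j) (sBe j) (iB j) (iB0 j) maxB1.
  by exists U; split=> //; rewrite /k' /k addrA lerD2r addrA.
exists I, B'; split.
  split=> [|j|j]; first by apply: subset_trans sI (subsetDl _ _).
    by have [] := B'P j.
  by have [] := B'P j.
rewrite lerBlDr -addrA lerD2l.
have le1 : local_weight c' B <= local_weight c B' + \sum_(j | e \in B j) b.
  rewrite /local_weight [X in _ + X]big_mkcond -big_split /=; apply: ler_sum => j _.
  by have [] := B'P j.
apply: le_trans le1 _; rewrite lerD2l sumr_const -mulr_natl /loss /b.
case: ifP => d0.
  rewrite ler_wpM2r // lerBrDr natr1 ler_nat.
  apply: proper_card; apply/properP; split; first by apply/subsetP => j; exact: eBJ.
  by exists j1.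
by rewrite mulr_ge0_le0 // mulr_le0_ge0 ?invr_ge0 ?ler0n // ltW // ltNge d0.
Qed.

(** Induction on the number of global elements, at an extreme optimum of the
    relaxation for the given weights. *)
Lemma matchoid_roundable (p : nat) X : (2 <= p)%N ->
  (forall f : T, (#|[set j : 'I_m | f \in ground (M j)]| <= p)%N) ->
  (forall f : T, exists j, f \in ground (M j)) ->
  roundable (p%:R - 1 + p%:R^-1) X.
Proof.
move=> p2 degp cov; set a := p%:R - 1 + p%:R^-1.
have a1 : 1 <= a.
  have : 2 <= p%:R :> R by rewrite (ler_nat R 2).
  have : 0 <= p%:R^-1 :> R by rewrite invr_ge0.
  by rewrite /a; lra.
have [n le_n] := ubnP #|X|; elim: n X le_n => // n IH X le_n w c v0 B0 relv0 sB0 iB0.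
pose C (s : T + 'I_m * T) := match s with
  | inl e => if e \in X then w e else 0
  | inr (j, e) => if e \in ground (M j) :\: X then c j e else 0 end.
have lpE u : lp_value X w c u = \sum_s C s * u s.
  rewrite big_sumType /= /lp_value; congr (_ + _).
    rewrite big_mkcond; apply: eq_bigr => e _; case: ifP => //; by rewrite mul0r.
  rewrite (eq_bigr (fun j => \sum_e C (inr (j, e)) * u (inr (j, e)))).
    by rewrite pair_bigA; apply: eq_bigr => -[].
  move=> j _; rewrite big_mkcond; apply: eq_bigr => e _ /=; case: ifP => //.
  by rewrite mul0r.
have [v [relv maxv extv]] := relaxation_extreme_maximizer C relv0.
suff [I [B [rIB le]]] : has_rounding a X w c v B0.
  exists I, B; split=> //; apply: le_trans le; rewrite lerD2r ler_wpM2l //.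
    by rewrite invr_ge0 (le_trans ler01).
  by rewrite !lpE maxv.
have rX e : e \in X -> roundable a (X :\ e).
  move=> eX; apply: IH; rewrite -ltnS (leq_trans _ le_n) // ltnS.
  by rewrite [ltnRHS](cardsD1 e) eX.
have [/existsP[e /andP[eX ve]]|no_zero] :=
  boolP [exists e, (e \in X) && (v (inl e) == 0)].
  by apply: roundable_zero (rX e eX) _ _ _ _ _ _ _ _ => //; apply/eqP.
have [/existsP[e /andP[eX ve]]|no_big] :=
  boolP [exists e, (e \in X) && (1 <= p%:R * v (inl e))].
  exact: (roundable_reinsert degp (cov e) eX (rX e eX)).
have small e : e \in X -> p%:R * v (inl e) < 1.
  move=> eX; rewrite ltNge; apply: contra no_big => h; apply/existsP; exists e.
  by rewrite eX.
have int := extreme_integral degp relv extv small.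
have X0 : X = finset.set0.
  apply/setP => e; rewrite inE; apply/negbTE/negP => eX.
  case: (int (inl e)) => ve.
    by case/negP: no_zero; apply/existsP; exists e; rewrite eX ve eqxx.
  by have := small e eX; rewrite ve mulr1 ltNge ler1n ltnW.
by move: relv; rewrite X0 => relv; apply: integral_rounding.
Qed.

End Rounding.

(** * The integrality gap *)

Local Open Scope classical_set_scope.
Local Open Scope ring_scope.

Theorem theorem1p3 (R : realType) (p : nat) (hp : (2 <= p)%N)
    (T : finType) (m : nat) (M : 'I_m -> matroid T) (hM : is_matchoid M p)
    (w : T -> R) :
  exists lp_opt int_opt : R,
    [/\ is_max [set \sum_(e : T) w e * x e | x in matchoid_polytope M] lp_opt,
        is_max [set \sum_(e in I) w e | I in feasible M] int_opt &
        lp_opt <= (p%:R - 1 + p%:R^-1) * int_opt].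
Proof.
have [covE degp] := hM.
have cov e : exists j, e \in ground (M j).
  by have : e \in [set: T]%SET by []; rewrite -covE => /bigcupP[j _ ej]; exists j.
(* the polytope is the relaxation in which every element is global *)
have copy_varE (j : 'I_m) e : copy_var [set: T]%SET j e = inl e by rewrite /copy_var inE.
have polyE (v : T + 'I_m * T -> R) :
    relaxation M [set: T]%SET v -> matchoid_polytope M (v \o inl).
  case=> box rk; split=> [e|j]; first exact: box.
  split=> [e _|S sS]; first by case/andP: (box (inl e)).
  apply: le_trans (rk j S sS); rewrite le_eqVlt; apply/orP; left; apply/eqP.
  by apply: eq_bigr => e _; rewrite copy_varE.
pose ext (x : T -> R) : T + 'I_m * T -> R := fun s => if s is inl e then x e else 0.
have extP x : matchoid_polytope M x -> relaxation M [set: T]%SET (ext x).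
  case=> box rk; split=> [[e|q] /=|j S sS]; rewrite ?lexx ?ler01 //.
  apply: le_trans (proj2 (rk j) S sS); rewrite le_eqVlt; apply/orP; left; apply/eqP.
  by apply: eq_bigr => e _; rewrite copy_varE.
have costE v : \sum_s ext w s * v s = \sum_e w e * v (inl e).
  by rewrite big_sumType /= [X in _ + X]big1 ?addr0 // => q _; rewrite mul0r.
have zeroP : relaxation M [set: T]%SET (fun=> 0 : R).
  by split=> [s|j S _]; rewrite ?lexx ?ler01 // big1.
have [v [relv maxv _]] := relaxation_extreme_maximizer (ext w) zeroP.
pose feasb (I : {set T}) := [forall j, I :&: ground (M j) \in indep (M j)]%SET.
have feas0 : feasb finset.set0.
  by apply/forallP => j; rewrite finset.set0I indep0.
have [I0 feasI0 maxI0] :=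
  @arg_maxP _ _ _ finset.set0 feasb (fun I : {set T} => \sum_(e in I) w e) feas0.
exists (\sum_e w e * v (inl e)), (\sum_(e in I0) w e); split.
- split; first by exists (v \o inl) => //; exact: polyE.
  by move=> _ [x Px <-]; have := maxv _ (extP x Px); rewrite !costE.
- split; first by exists I0 => // j; exact: (forallP feasI0).
  by move=> _ [I feasI <-]; apply: maxI0; apply/forallP; exact: feasI.
have a0 : 0 < p%:R - 1 + p%:R^-1 :> R.
  by rewrite ltr_wpDl ?invr_gt0 ?subr_ge0 ?ler1n ?ltr0n // ltnW // ltnW.
have [||I [B [[_ _ iB]]]] :=
  matchoid_roundable hp degp cov w (fun _ _ => 0) (B0 := fun=> finset.set0) relv.
- by move=> j; rewrite sub0set.
- by move=> j; exact: indep0.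
have local0 C : local_weight (fun (_ : 'I_m) (_ : T) => 0 : R) C = 0.
  by rewrite /local_weight big1 // => j _; rewrite big1.
rewrite !local0 mulr0 !addr0 mulrC ler_pdivrMr // => le.
have -> : \sum_e w e * v (inl e) = lp_value M [set: T]%SET w (fun _ _ => 0) v.
  rewrite /lp_value [X in _ + X]big1 ?addr0.
    by apply: eq_bigl => e; rewrite inE.
  by move=> j _; rewrite big1 // => e _; rewrite mul0r.
apply: le_trans le _; rewrite mulrC ler_pM2l //; apply: maxI0.
by apply/forallP => j; apply: indep_sub (iB j) _; exact: subsetUl.
Qed.
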